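(* The constant $\frac{\omega+1}{2\sqrt{\omega}}$ is best possible in the inequality $$|A_1+\cdots+A_m|\le\frac{\omega+1}{2\sqrt{\omega}}\bigl(|A_1|+\cdots+|A_m|\bigr),$$ valid for all invertible $A_1,\dots,A_m\in\mathbb{M}_n$ with condition numbers bounded by $\omega$. More precisely, already for $m=n=2$: for every $\omega\ge1$ and every real $c<\frac{\omega+1}{2\sqrt{\omega}}$ there exist invertible $A_1,A_2\in\mathbb{M}_2$ with $\kappa(A_1)=\kappa(A_2)=\omega$ such that the inequality $|A_1+A_2|\le c\,\bigl(|A_1|+|A_2|\bigr)$ fails.
   Context: $\mathbb{M}_n$ is the space of $n\times n$ complex matrices; $|Z|=(Z^*Z)^{1/2}$. The condition number of an invertible $A\in\mathbb{M}_n$ is $\kappa(A)=\|A\|_\infty\|A^{-1}\|_\infty$, with $\|\cdot\|_\infty$ the spectral norm. For Hermitian matrices, $X\le Y$ means $Y-X$ is positive semidefinite. The displayed inequality with constant $\frac{\omega+1}{2\sqrt\omega}$ is a known theorem of Lee; the claim to be proved is the sharpness of the constant. *)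

(* Defs.v *)
(* For R : realType, R[i] is the field of complex numbers. *)
From HB Require Import structures.
From mathcomp Require Import all_boot all_order all_algebra.
From mathcomp Require Import all_classical all_reals.
From mathcomp Require Export complex.

Set Implicit Arguments.
Unset Strict Implicit.
Unset Printing Implicit Defensive.

Import Order.TTheory GRing.Theory Num.Theory.
Local Open Scope classical_set_scope.
Local Open Scope ring_scope.
Local Open Scope sesquilinear_scope.

Definition psdmx (C : numClosedFieldType) (n : nat) (A : 'M[C]_n) : Prop :=
  A \is hermsymmx /\ forall x : 'cV[C]_n, 0 <= (x^t* *m A *m x) 0 0.

Definition loewner_le (C : numClosedFieldType) (n : nat) (X Y : 'M[C]_n) :=
  psdmx (Y - X).

(* The square root is applied to the eigenvalues in a unitary diagonalization
   of A. For positive semidefinite A the result is the positive semidefinite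
   square root of A (psdmx_sqrtmx, sqrtmxK); other A are irrelevant here. *)
Definition sqrtmx (C : numClosedFieldType) (n : nat) (A : 'M[C]_n) : 'M[C]_n :=
  invmx (spectralmx A) *m diag_mx (map_mx sqrtC (spectral_diag A))
    *m spectralmx A.

Definition absmx (C : numClosedFieldType) (n : nat) (Z : 'M[C]_n) : 'M[C]_n :=
  sqrtmx (Z^t* *m Z).

Lemma diag_form (C : numClosedFieldType) n (d : 'rV[C]_n) (y : 'cV[C]_n) :
  (y^t* *m diag_mx d *m y) 0 0 = \sum_i d 0 i * `|y i 0| ^+ 2.
Proof.
rewrite mxE; apply: eq_bigr => i _.
by rewrite mul_mx_diag !mxE mulrAC mulrC normCKC.
Qed.

Lemma psdmx_spectral_diag_ge0 (C : numClosedFieldType) n (A : 'M[C]_n) :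
  psdmx A -> forall i, 0 <= spectral_diag A 0 i.
Proof.
move=> [hA pA] i; have /hermitian_normalmx/orthomx_spectralP eA := hA.
have /unitarymxP UU := spectral_unitarymx A.
have := pA ((spectralmx A)^t* *m delta_mx i 0).
rewrite {2}eA invmx_unitary ?spectral_unitarymx //.
have -> : ((spectralmx A)^t* *m delta_mx i 0)^t* =
    (delta_mx i 0 : 'cV[C]_n)^t* *m spectralmx A.
  by rewrite trmx_mul map_mxM /= trmxCK.
rewrite !mulmxA !mulmxtVK ?spectral_unitarymx // diag_form.
rewrite (bigD1 i) //= big1 ?addr0 => [|j /negbTE ji]; rewrite !mxE.
  by rewrite !eqxx normr1 expr1n mulr1.
by rewrite ji normr0 expr0n mulr0.
Qed.

Lemma sqrtmxK (C : numClosedFieldType) n (A : 'M[C]_n) :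
  A \is hermsymmx -> sqrtmx A *m sqrtmx A = A.
Proof.
move=> /hermitian_normalmx/orthomx_spectralP eA.
rewrite /sqrtmx !mulmxA mulmxK ?spectral_unit // -[_ *m diag_mx _ *m diag_mx _]mulmxA.
rewrite mulmx_diag [RHS]eA; congr (_ *m diag_mx _ *m _).
by apply/rowP => j; rewrite !mxE -expr2 sqrtCK.
Qed.

Lemma psdmx_sqrtmx (C : numClosedFieldType) n (A : 'M[C]_n) :
  psdmx A -> psdmx (sqrtmx A).
Proof.
move=> pA; have d0 := psdmx_spectral_diag_ge0 pA.
rewrite /sqrtmx invmx_unitary ?spectral_unitarymx //; split.
  apply/is_hermitianmxP; rewrite expr0 scale1r !trmx_mul !map_mxM /= trmxCK.
  rewrite tr_diag_mx map_diag_mx mulmxA; congr (_ *m diag_mx _ *m _).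
  apply/rowP => j; rewrite !mxE; apply/esym/CrealP.
  by rewrite ger0_real // sqrtC_ge0.
move=> x; rewrite !mulmxA.
have -> : x^t* *m (spectralmx A)^t* = (spectralmx A *m x)^t*.
  by rewrite trmx_mul map_mxM.
rewrite -[_ *m _ *m x]mulmxA diag_form sumr_ge0 // => j _.
by rewrite mulr_ge0 ?exprn_ge0 // mxE sqrtC_ge0.
Qed.

Lemma psdmx_gram (C : numClosedFieldType) n (Z : 'M[C]_n) : psdmx (Z^t* *m Z).
Proof.
split.
  by apply/is_hermitianmxP; rewrite expr0 scale1r trmx_mul map_mxM /= trmxCK.
move=> x; rewrite mulmxA.
have -> : x^t* *m Z^t* = (Z *m x)^t* by rewrite trmx_mul map_mxM.
rewrite -[_ *m _ *m x]mulmxA mxE sumr_ge0 // => j _.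
by rewrite !mxE mulrC mul_conjC_ge0.
Qed.

Definition norm2 (R : realType) (n : nat) (x : 'cV[R[i]]_n) : R :=
  Num.sqrt (\sum_i (Normc.normc (x i 0)) ^+ 2).

Definition spectral_norm (R : realType) (n : nat) (A : 'M[R[i]]_n) : R :=
  sup [set norm2 (A *m x) | x in [set x : 'cV[R[i]]_n | norm2 x <= 1]].

Definition cond_num (R : realType) (n : nat) (A : 'M[R[i]]_n) : R :=
  spectral_norm A * spectral_norm (invmx A).

(* c is admissible for omega when the inequality
   |A_1 + ... + A_m| <= c (|A_1| + ... + |A_m|) holds for all m, n and all
   invertible n x n matrices A_i with condition numbers at most omega. *)
Definition admissible (R : realType) (omega c : R) : Prop :=
  forall (m n : nat) (A : 'I_m -> 'M[R[i]]_n),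
    (0 < m)%N -> (0 < n)%N ->
    (forall i, A i \in unitmx) -> (forall i, cond_num (A i) <= omega) ->
    loewner_le (absmx (\sum_i A i)) (c%:C%C *: \sum_i absmx (A i)).

(* Main.v *)
(* Let P = diag(1, omega), let x = (sqrt omega, 1) / sqrt (omega + 1), and let
   H = 2 x x^* - 1 be the reflection fixing x. Take A_1 = P and A_2 = P H. Then
   A_1 + A_2 = 2 (P x) x^* has rank one, so |A_1 + A_2| = 2 |P x| x x^*, whereas
   |A_1| = P and |A_2| = H P H agree at x because H x = x. The inequality at x
   becomes |P x| <= c <P x, x>, and x is the unit vector for which the
   Kantorovich inequality |P x| <= (omega + 1) / (2 sqrt omega) <P x, x> is an
   equality. *)
Require Import Defs.
From mathcomp Require Import all_boot all_order all_algebra.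
From mathcomp Require Import all_classical all_reals.
From mathcomp Require Import ring.

Set Implicit Arguments.
Unset Strict Implicit.
Unset Printing Implicit Defensive.

Import Order.TTheory GRing.Theory Num.Theory.
Local Open Scope ring_scope.
Local Open Scope sesquilinear_scope.

(** * Adjoints, Hermitian matrices and Gram entries *)

Lemma trmxC_mul (C : numClosedFieldType) m n p (A : 'M[C]_(m, n))
  (B : 'M[C]_(n, p)) : (A *m B)^t* = B^t* *m A^t*.
Proof. by rewrite trmx_mul map_mxM. Qed.

Lemma hermsymmx_trmxC (C : numClosedFieldType) n (A : 'M[C]_n) :
  A \is hermsymmx -> A^t* = A.
Proof. by move/is_hermitianmxP; rewrite expr0 scale1r. Qed.

Lemma trmxC_hermsymmx (C : numClosedFieldType) n (A : 'M[C]_n) :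
  A^t* = A -> A \is hermsymmx.
Proof. by move=> eA; apply/is_hermitianmxP; rewrite expr0 scale1r. Qed.

Lemma gram_ge0 (C : numClosedFieldType) n (x : 'cV[C]_n) :
  0 <= (x^t* *m x) 0 0.
Proof.
by rewrite mxE sumr_ge0 // => j _; rewrite !mxE mulrC mul_conjC_ge0.
Qed.

(** * Uniqueness of the positive semidefinite square root *)

(** By the spectral theorem [D] is unitarily similar to the diagonal matrix of its eigenvalues,
    which are real, so it suffices that each of these vanishes. *)
Lemma hermsymmx_eq0 (C : numClosedFieldType) n (D : 'M[C]_n) :
  D \is hermsymmx ->
  (forall (v : 'cV[C]_n) (a : C), a \is Num.real -> v^t* *m v = 1%:M ->
     D *m v = a *: v -> a = 0) ->
  D = 0.
Proof.
move=> hD eig0; have /orthomx_spectralP eD := hermitian_normalmx hD.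
have uU := spectral_unitarymx D.
suff d0 : spectral_diag D = 0 by rewrite eD d0 linear0 mulmx0 mul0mx.
apply/rowP => i; rewrite [RHS]mxE.
(* The adjoint of the diagonalizing unitary has the eigenvectors as columns; [v] is the one for the
   [i]-th eigenvalue, kept opaque to control rewriting. *)
have [v defv] : exists v, v = (spectralmx D)^t* *m (delta_mx i 0 : 'cV[C]_n).
  by eexists.
have Uv : spectralmx D *m v = delta_mx i 0.
  by rewrite defv mulmxA; have /unitarymxP -> := uU; rewrite mul1mx.
apply: (eig0 v).
- exact: (mxOverP (hermitian_spectral_diag_real hD)).
- rewrite {1}defv trmxC_mul trmxCK -mulmxA Uv; apply/matrixP => j k.
  rewrite !ord1 !mxE (bigD1 i) //= big1 ?addr0 => [|l /negbTE li].
    by rewrite !mxE !eqxx conjC1 mulr1.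
  by rewrite !mxE li mulr0.
rewrite {1}eD -(mulmxA _ _ v) Uv invmx_unitary // defv scalemxAr -mulmxA.
congr (_ *m _).
apply/colP => j; rewrite mul_diag_mx !mxE.
by case: (eqVneq j i) => [->|]; rewrite ?mulr0.
Qed.

(* D = S - T satisfies S D + D T = 0, so an eigenpair (a, v) of D has
   a <v, (S + T) v> = 0; if a != 0 then <v, S v> = <v, T v> = 0, hence
   a = <v, D v> = 0 as well. *)
Lemma psdmx_sqr_inj (C : numClosedFieldType) n (S T : 'M[C]_n) :
  psdmx S -> psdmx T -> S *m S = T *m T -> S = T.
Proof.
move=> [hS pS] [hT pT] eST; apply/subr0_eq.
have eS := hermsymmx_trmxC hS; have eT := hermsymmx_trmxC hT.
have eD : (S - T)^t* = S - T by rewrite linearB /= map_mxB eS eT.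
apply: hermsymmx_eq0 => [|v a /CrealP aR v1 Dv]; first exact: trmxC_hermsymmx.
have vD : v^t* *m (S - T) = a *: v^t*.
  by rewrite -{1}eD -trmxC_mul Dv linearZ /= map_mxZ /= aR.
have key : a *: (v^t* *m S *m v + v^t* *m T *m v) = 0.
  have : v^t* *m (S *m (S - T) + (S - T) *m T) *m v = 0.
    by rewrite mulmxBr mulmxBl addrA subrK eST subrr mulmx0 mul0mx.
  rewrite mulmxDr mulmxDl !mulmxA vD -[_ *m _ *m v]mulmxA Dv.
  by rewrite -scalemxAr -!scalemxAl -scalerDr.
have /eqP := congr1 (fun M : 'M_1 => M 0 0) key.
rewrite [X in X == _]mxE [X in _ * X]mxE [X in _ == X]mxE mulf_eq0.
case/orP => [/eqP//|]; rewrite paddr_eq0 // => /andP[/eqP vSv /eqP vTv].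
have := congr1 (fun y : 'cV_n => (v^t* *m y) 0 0) Dv.
rewrite /= -scalemxAr v1 mulmxA mulmxBr mulmxBl [LHS]mxE [X in _ + X]mxE.
by rewrite vSv vTv subrr !mxE eqxx mulr1.
Qed.

(** * Closed forms of absolute values *)

(** This avoids computing with the diagonalization hidden in [sqrtmx]: exhibiting any positive
    semidefinite square root of [Z^* Z] is enough. *)
Lemma absmx_unique (C : numClosedFieldType) n (Z T : 'M[C]_n) :
  psdmx T -> T *m T = Z^t* *m Z -> absmx Z = T.
Proof.
move=> pT eT; apply: psdmx_sqr_inj => //.
  by apply: psdmx_sqrtmx; apply: psdmx_gram.
by rewrite eT sqrtmxK //; have [] := psdmx_gram Z.
Qed.

Lemma absmx_psd (C : numClosedFieldType) n (P : 'M[C]_n) :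
  psdmx P -> absmx P = P.
Proof.
by move=> pP; apply: absmx_unique => //; rewrite hermsymmx_trmxC //; case: pP.
Qed.

(** Since [U U^* = 1], the square of [U^* P U] is [U^* P^2 U = (P U)^* (P U)]. *)
Lemma absmx_psd_unitary (C : numClosedFieldType) n (P U : 'M[C]_n) :
  psdmx P -> U \is unitarymx -> absmx (P *m U) = U^t* *m P *m U.
Proof.
move=> [hP pP] uU; have eP := hermsymmx_trmxC hP; apply: absmx_unique.
  split; first by apply: trmxC_hermsymmx; rewrite !trmxC_mul trmxCK eP mulmxA.
  by move=> x; have := pP (U *m x); rewrite trmxC_mul !mulmxA.
by rewrite trmxC_mul eP !mulmxA mulmxtVK.
Qed.

Lemma absmx_rank1 (C : numClosedFieldType) n (x y : 'cV[C]_n) :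
  x^t* *m x = 1%:M ->
  absmx (y *m x^t*) = sqrtC ((y^t* *m y) 0 0) *: (x *m x^t*).
Proof.
move=> x1; set s := sqrtC _.
have s0 : 0 <= s by rewrite sqrtC_ge0 gram_ge0.
apply: absmx_unique.
  split.
    apply: trmxC_hermsymmx; rewrite linearZ /= map_mxZ /= trmxC_mul trmxCK.
    by rewrite (CrealP (ger0_real s0)).
  move=> z; rewrite -scalemxAr -scalemxAl mxE mulr_ge0 //.
  by have := gram_ge0 (x^t* *m z); rewrite trmxC_mul trmxCK !mulmxA.
rewrite -scalemxAl -scalemxAr scalerA -expr2 sqrtCK trmxC_mul trmxCK !mulmxA.
rewrite -[x *m _ *m x]mulmxA x1 mulmx1 -[x *m _ *m y]mulmxA.
rewrite [in RHS](mx11_scalar (y^t* *m y)).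
by rewrite mul_mx_scalar scalemxAl.
Qed.

(** * The reflection and the inequality it forces *)

Definition reflection (C : numClosedFieldType) n (x : 'cV[C]_n) : 'M[C]_n :=
  2 *: (x *m x^t*) - 1%:M.

Lemma reflection_fix (C : numClosedFieldType) n (x : 'cV[C]_n) :
  x^t* *m x = 1%:M -> reflection x *m x = x.
Proof.
move=> x1; rewrite mulmxBl -scalemxAl -mulmxA x1 mulmx1 mul1mx.
by rewrite scaler_nat mulr2n addrK.
Qed.

Lemma reflection_trmxC (C : numClosedFieldType) n (x : 'cV[C]_n) :
  (reflection x)^t* = reflection x.
Proof.
rewrite linearB linearZ /= map_mxB map_mxZ /= trmxC_mul trmxCK trmx1 map_mx1.
by rewrite conjC_nat.
Qed.

(** [H] is Hermitian, and [H x = x] gives [H H = 2 x x^* - H = 1]. *)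
Lemma reflection_unitary (C : numClosedFieldType) n (x : 'cV[C]_n) :
  x^t* *m x = 1%:M -> reflection x \is unitarymx.
Proof.
move=> x1; apply/unitarymxP; rewrite reflection_trmxC {2}/reflection.
rewrite mulmxBr -scalemxAr mulmxA reflection_fix // mulmx1.
by rewrite /reflection opprB addrCA subrr addr0.
Qed.

(** Testing the Loewner inequality at the single vector [x] gives [2 |P x|] on the left and
    [2 c x^* P x] on the right; the factor 2 cancels. *)
Lemma loewner_reflection (C : numClosedFieldType) n (P : 'M[C]_n)
  (x : 'cV[C]_n) (c : C) (H := reflection x) :
  psdmx P -> x^t* *m x = 1%:M ->
  loewner_le (absmx (P + P *m H)) (c *: (absmx P + absmx (P *m H))) ->
  sqrtC (((P *m x)^t* *m (P *m x)) 0 0) <= c * (x^t* *m P *m x) 0 0.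
Proof.
move=> pP x1; have Hx : H *m x = x := reflection_fix x1.
have uH : H \is unitarymx := reflection_unitary x1.
have -> : P + P *m H = (2 *: (P *m x)) *m x^t*.
  by rewrite mulmxBr mulmx1 addrC subrK -scalemxAr -scalemxAl mulmxA.
rewrite absmx_rank1 // absmx_psd // absmx_psd_unitary // => -[_ /(_ x)].
rewrite mulmxBr mulmxBl -!scalemxAr -!scalemxAl mulmxDr mulmxDl.
have -> : x^t* *m (H^t* *m P *m H) *m x = x^t* *m P *m x.
  by rewrite !mulmxA -trmxC_mul Hx -mulmxA Hx.
have -> : (2 *: (P *m x))^t* = 2 *: (P *m x)^t*.
  by rewrite linearZ /= map_mxZ /= conjC_nat.
have -> : x^t* *m (x *m x^t*) *m x = 1%:M by rewrite mulmxA x1 mul1mx.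
rewrite -scalemxAl scalerA -expr2 -mulr2n.
set q := (P *m x)^t* *m (P *m x).
have q0 : 0 <= q 0 0 by exact: gram_ge0.
have -> : ((2 ^+ 2 : C) *: q) 0 0 = 2 ^+ 2 * q 0 0 by rewrite mxE.
rewrite sqrtCM ?nnegrE ?exprn_ge0 ?ler0n // exprCK ?ler0n // !mxE eqxx mulr1.
by rewrite mulr2n -mulr2n mulrnAr -mulr_natl -mulrBr pmulr_rge0 ?ltr0n // subr_ge0.
Qed.

(** * Unitary invariance of the spectral norm and the condition number *)

Lemma unitarymx_mulmxV (C : numClosedFieldType) n (U : 'M[C]_n) :
  U \is unitarymx -> U *m U^t* = 1%:M.
Proof. by move/unitarymxP. Qed.

Lemma gram_unitary (C : numClosedFieldType) n (U : 'M[C]_n) (x : 'cV[C]_n) :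
  U \is unitarymx -> (U *m x)^t* *m (U *m x) = x^t* *m x.
Proof.
move=> uU; rewrite trmxC_mul mulmxA -{2}(trmxCK U).
by rewrite mulmxtVK ?trmxC_unitary.
Qed.

Lemma invmx_mul_unitary (C : numClosedFieldType) n (A U : 'M[C]_n) :
  A \in unitmx -> U \is unitarymx -> invmx (A *m U) = U^t* *m invmx A.
Proof.
move=> uA uU; have uAU : A *m U \in unitmx by rewrite unitmx_mul uA unitarymx_unit.
apply: (can_inj (mulKmx uAU)).
by rewrite mulmxV // mulmxA mulmxtVK // mulmxV.
Qed.

(** Links the real-valued norm to the matrix product [x^* x], whose invariance under unitaries is
    algebraic. *)
Lemma norm2_gram (R : realType) n (x : 'cV[R[i]]_n) :
  norm2 x = Num.sqrt (complex.Re ((x^t* *m x) 0 0)).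
Proof.
congr Num.sqrt; rewrite mxE raddf_sum; apply: eq_bigr => i _.
by rewrite !mxE mulrC -normCK -rmorphXn.
Qed.

Lemma norm2_unitary (R : realType) n (U : 'M[R[i]]_n) (x : 'cV[R[i]]_n) :
  U \is unitarymx -> norm2 (U *m x) = norm2 x.
Proof.
by move=> uU; rewrite !norm2_gram gram_unitary.
Qed.

Lemma spectral_norm_unitaryl (R : realType) n (U A : 'M[R[i]]_n) :
  U \is unitarymx -> spectral_norm (U *m A) = spectral_norm A.
Proof.
move=> uU; rewrite /spectral_norm; congr sup; apply: eq_imagel => x _.
by rewrite -mulmxA norm2_unitary.
Qed.

(** [x |-> U x] maps the unit ball onto itself, with inverse [U^*], so both suprema range over the
    same set. *)
Lemma spectral_norm_unitaryr (R : realType) n (A U : 'M[R[i]]_n) :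
  U \is unitarymx -> spectral_norm (A *m U) = spectral_norm A.
Proof.
move=> uU; rewrite /spectral_norm; congr sup; apply/seteqP; split => _ [x /= x1 <-].
  by exists (U *m x); rewrite /= ?(norm2_unitary _ uU) // mulmxA.
have uU' : U^t* \is unitarymx by rewrite trmxC_unitary.
exists (U^t* *m x); rewrite /= ?(norm2_unitary _ uU') // mulmxA.
by rewrite -(mulmxA A) (unitarymx_mulmxV uU) mulmx1.
Qed.

Lemma cond_num_unitaryr (R : realType) n (A U : 'M[R[i]]_n) :
  A \in unitmx -> U \is unitarymx -> cond_num (A *m U) = cond_num A.
Proof.
move=> uA uU; have uU' : U^t* \is unitarymx by rewrite trmxC_unitary.
by rewrite /cond_num (spectral_norm_unitaryr _ uU) (invmx_mul_unitary uA uU)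
  (spectral_norm_unitaryl _ uU').
Qed.

(** * Diagonal matrices *)

(** The entry of largest modulus bounds the stretching coordinatewise, and the [k]-th basis vector
    attains the bound. *)
Lemma spectral_norm_diag (R : realType) n (d : 'rV[R[i]]_n) (k : 'I_n) :
  (forall j, Normc.normc (d 0 j) <= Normc.normc (d 0 k)) ->
  spectral_norm (diag_mx d) = Normc.normc (d 0 k).
Proof.
move=> dk; have n0 z : 0 <= Normc.normc z :> R by case: z => a b; exact: sqrtr_ge0.
have ub : ubound [set norm2 (diag_mx d *m x) | x in
    [set x : 'cV[R[i]]_n | norm2 x <= 1]]%classic (Normc.normc (d 0 k)).
  move=> _ [x /= x1 <-]; rewrite -[leRHS]mulr1.
  apply: le_trans (ler_wpM2l (n0 _) x1).
  rewrite -[X in X * norm2 _]ger0_norm // -sqrtr_sqr -sqrtrM ?sqr_ge0 // ler_sqrt.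
    rewrite mulr_sumr ler_sum // => j _; rewrite mul_diag_mx mxE Normc.normcM exprMn.
    by rewrite ler_wpM2r ?sqr_ge0 // lerXn2r ?nnegrE.
  by rewrite mulr_ge0 ?sqr_ge0 ?sumr_ge0 // => j _; rewrite sqr_ge0.
(* Used three times: [a = 0] for nonemptiness of the set, [a = 1] for membership of the basis vector
   in the ball, and the [k]-th entry of [d] for the value attained. *)
have n2 (a : R[i]) : norm2 (a *: (delta_mx k 0 : 'cV[R[i]]_n)) = Normc.normc a.
  rewrite /norm2 (bigD1 k) //= big1 ?addr0 => [|j /negbTE jk].
    by rewrite !mxE !eqxx mulr1 sqrtr_sqr ger0_norm.
  by rewrite !mxE jk mulr0 Normc.normc0 expr0n.
apply/le_anti/andP; split.
  apply: ge_sup ub; exists (norm2 (diag_mx d *m 0)), 0 => //=.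
  by rewrite -(scale0r (delta_mx k 0)) n2 Normc.normc0.
apply: ub_le_sup; first by exists (Normc.normc (d 0 k)).
exists (delta_mx k 0) => /=; first by rewrite -[delta_mx _ _]scale1r n2 Normc.normc1.
rewrite -n2; congr norm2; apply/colP => j; rewrite mul_diag_mx !mxE.
by case: (eqVneq j k) => [->|]; rewrite ?mulr0.
Qed.

Lemma diag_mx_mulV (F : fieldType) n (d : 'rV[F]_n) :
  (forall j, d 0 j != 0) -> diag_mx d *m diag_mx (map_mx GRing.inv d) = 1%:M.
Proof.
move=> d0; rewrite mulmx_diag -diag_const_mx; congr diag_mx.
by apply/rowP => j; rewrite !mxE divff.
Qed.

(** Inversion reverses the order of the moduli, so the norm of the inverse is attained at [l]. *)
Lemma cond_num_diag (R : realType) n (d : 'rV[R[i]]_n) (k l : 'I_n) :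
  (forall j, d 0 j != 0) ->
  (forall j, Normc.normc (d 0 l) <= Normc.normc (d 0 j) <= Normc.normc (d 0 k)) ->
  diag_mx d \in unitmx /\
  cond_num (diag_mx d) = Normc.normc (d 0 k) / Normc.normc (d 0 l).
Proof.
move=> d0 dlk; have dV := diag_mx_mulV d0; have [ud _] := mulmx1_unit dV.
split => //; rewrite /cond_num.
have -> : invmx (diag_mx d) = diag_mx (map_mx GRing.inv d).
  by apply: (can_inj (mulKmx ud)); rewrite mulmxV.
have n0 j : 0 < Normc.normc (d 0 j).
  rewrite lt_def; apply/andP; split; last by case: (d 0 j) => a b; exact: sqrtr_ge0.
  by apply: contra (d0 j) => /eqP/Normc.eq0_normc ->.
rewrite (@spectral_norm_diag _ _ _ k) => [|j]; last by have /andP[] := dlk j.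
rewrite (@spectral_norm_diag _ _ _ l) => [|j]; rewrite !mxE !Normc.normcV //.
by rewrite lef_pV2 ?posrE //; have /andP[] := dlk j.
Qed.

Lemma psdmx_diag (C : numClosedFieldType) n (d : 'rV[C]_n) :
  (forall j, 0 <= d 0 j) -> psdmx (diag_mx d).
Proof.
move=> d0; split.
  apply: trmxC_hermsymmx; rewrite tr_diag_mx map_diag_mx; congr diag_mx.
  by apply/rowP => j; rewrite !mxE; apply/CrealP; exact: ger0_real.
by move=> x; rewrite diag_form sumr_ge0 // => j _; rewrite mulr_ge0 ?exprn_ge0.
Qed.

(** * Real data inside the complex numbers *)

Lemma sqrtC_real_complex (R : rcfType) (a : R) :
  0 <= a -> sqrtC a%:C%C = (Num.sqrt a)%:C%C.
Proof.
move=> a0; rewrite -{1}(sqr_sqrtr a0) rmorphXn exprCK //.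
by rewrite -[0]/(0%:C%C) lecR sqrtr_ge0.
Qed.

Lemma normc_real_complex (R : rcfType) (a : R) :
  0 <= a -> Normc.normc a%:C%C = a.
Proof. by move=> a0; rewrite /= expr0n addr0 sqrtr_sqr ger0_norm. Qed.

(** Moves inner products of real vectors into [R], where [field] can evaluate them. *)
Lemma mulmx_real_col (R : rcfType) n (x y : 'I_n -> R) :
  (\col_j (x j)%:C%C)^t* *m (\col_j (y j)%:C%C) = (\sum_j x j * y j)%:C%C%:M.
Proof.
rewrite [LHS]mx11_scalar; congr (_%:M); rewrite mxE rmorph_sum.
apply: eq_bigr => j _.
by rewrite !mxE [RHS]rmorphM; congr (_ * _); exact: conjc_real.
Qed.

Lemma diag_mx_real_col (R : rcfType) n (d x : 'I_n -> R) :
  diag_mx (\row_j (d j)%:C%C) *m (\col_j (x j)%:C%C) =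
  \col_j (d j * x j)%:C%C.
Proof. by apply/colP => j; rewrite mul_diag_mx !mxE rmorphM. Qed.

(** * The extremal pair of 2 by 2 matrices *)

Theorem mainTheorem18 (R : realType) (omega : R) (omega_ge1 : 1 <= omega) :
  (forall c : R, admissible omega c ->
     (omega + 1) / (2 * Num.sqrt omega) <= c) /\
  (forall c : R, c < (omega + 1) / (2 * Num.sqrt omega) ->
     exists A1 A2 : 'M[R[i]]_2,
       [/\ A1 \in unitmx, A2 \in unitmx,
           cond_num A1 = omega, cond_num A2 = omega &
           ~ loewner_le (absmx (A1 + A2))
                        (c%:C%C *: (absmx A1 + absmx A2))]).
Proof.
(* The second claim comes first, because the lower bound on admissible constants follows from it by
   contradiction. *)
have sharp : forall c : R, c < (omega + 1) / (2 * Num.sqrt omega) ->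
     exists A1 A2 : 'M[R[i]]_2,
       [/\ A1 \in unitmx, A2 \in unitmx,
           cond_num A1 = omega, cond_num A2 = omega &
           ~ loewner_le (absmx (A1 + A2))
                        (c%:C%C *: (absmx A1 + absmx A2))].
  move=> c cK; have w0 : 0 < omega := lt_le_trans ltr01 omega_ge1.
  have w1 : 0 < omega + 1 by rewrite addr_gt0.
  pose d (j : 'I_2) : R := if j == 0 then 1 else omega.
  pose x (j : 'I_2) : R :=
    (if j == 0 then Num.sqrt omega else 1) / Num.sqrt (omega + 1).
  pose P := diag_mx (\row_j (d j)%:C%C); pose X := \col_j (x j)%:C%C.
  have d_gt0 j : 0 < d j by rewrite /d; case: ifP.
  have sw1 : Num.sqrt (omega + 1) != 0 by rewrite gt_eqF ?sqrtr_gt0.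
  have sqw1 : Num.sqrt (omega + 1) ^+ 2 = omega + 1 by rewrite sqr_sqrtr ?ltW.
  have sqw : Num.sqrt omega ^+ 2 = omega by rewrite sqr_sqrtr ?ltW.
  have X1 : X^t* *m X = 1%:M.
    rewrite mulmx_real_col; congr (_%:C%C%:M).
    have -> : \sum_j x j * x j =
        (Num.sqrt omega ^+ 2 + 1) / Num.sqrt (omega + 1) ^+ 2.
      by rewrite !big_ord_recl big_ord0 /x /=; field.
    by rewrite sqw sqw1 divff ?gt_eqF.
  have XPX : X^t* *m P *m X = (2 * omega / (omega + 1))%:C%C%:M.
    rewrite -mulmxA diag_mx_real_col mulmx_real_col; congr (_%:C%C%:M).
    have -> : \sum_j x j * (d j * x j) =
        (Num.sqrt omega ^+ 2 + omega) / Num.sqrt (omega + 1) ^+ 2.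
      by rewrite !big_ord_recl big_ord0 /x /d /=; field.
    by rewrite sqw sqw1 mulr_natl.
  have PXPX : (P *m X)^t* *m (P *m X) = omega%:C%C%:M.
    rewrite diag_mx_real_col mulmx_real_col; congr (_%:C%C%:M).
    have -> : \sum_j d j * x j * (d j * x j) =
        (Num.sqrt omega ^+ 2 + omega ^+ 2) / Num.sqrt (omega + 1) ^+ 2.
      by rewrite !big_ord_recl big_ord0 /x /d /=; field.
    by rewrite sqw sqw1; field; rewrite gt_eqF.
  have pP : psdmx P.
    by apply: psdmx_diag => j; rewrite mxE -[0]/(0%:C%C) lecR ltW.
  have [uP kP] : P \in unitmx /\ cond_num P = omega.
    have nd j : Normc.normc ((\row_j (d j)%:C%C) 0 j : R[i]) = d j.
      by rewrite mxE normc_real_complex ?ltW.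
    (* As [1 <= omega], index 1 carries the largest entry and index 0 the smallest. *)
    have [||-> ->] := @cond_num_diag R 2 (\row_j (d j)%:C%C) 1 0.
    - by move=> j; rewrite mxE fmorph_eq0 gt_eqF.
    - by move=> j; rewrite !nd /d /=; case: ifP; rewrite ?lexx ?omega_ge1.
    by rewrite !nd /d /= divr1.
  have uH := reflection_unitary X1.
  exists P, (P *m reflection X); split.
  - exact: uP.
  - by rewrite unitmx_mul uP unitarymx_unit.
  - exact: kP.
  - by rewrite (cond_num_unitaryr uP uH) kP.
  (* The inequality at [X] now reads [sqrt omega <= c * (2 omega / (omega + 1))]. *)
  move/(loewner_reflection pP X1); rewrite PXPX XPX !mxE !eqxx !mulr1n.
  rewrite (sqrtC_real_complex (ltW w0)) -(rmorphM (real_complex R)) lecR => le_c.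
  have s0 : 0 < Num.sqrt omega by rewrite sqrtr_gt0.
  move: cK; rewrite ltNge => /negP; apply.
  have -> : (omega + 1) / (2 * Num.sqrt omega) =
      Num.sqrt omega / (2 * omega / (omega + 1)).
    (* Writing the [omega] of [2 * omega] as a square leaves an identity of rational functions in
       [sqrt omega] and [omega]. *)
    by rewrite -{4}sqw; field; rewrite !gt_eqF.
  by rewrite ler_pdivrMr // divr_gt0 // mulr_gt0.
(* An admissible [c] below the constant would contradict [sharp] on the family [A1], [A2] with
   [m = n = 2]. *)
split=> // c adm; rewrite leNgt; apply/negP => /sharp[A1 [A2 [u1 u2 k1 k2 []]]].
have := adm 2 2 (fun i => if i == 0 then A1 else A2) isT isT.
rewrite !big_ord_recl !big_ord0 /= !addr0; apply => i; case: ifP => _ //.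
- by rewrite k1.
- by rewrite k2.
Qed.
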